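(* There exists $A \subset \mathbb{N}_0$ with $A^2 + A^2 = \mathbb{N}_0$ and $A(X) = O\!\left(\frac{\sqrt{X}}{(\log X)^{1/4}}\right)$ as $X\to\infty$.
   Context: $\mathbb{N}_0$ is the set of nonnegative integers. $A^2=\{ab: a,b\in A\}$ and $A^2+A^2=\{x+y: x,y\in A^2\}$. $A(X)=|A\cap[1,X]|$. *)

(* Defs.v *)
From Stdlib Require Import Reals Lra Lia Arith List.
Open Scope R_scope.

Definition sumset_prod_covers (A : nat -> bool) : Prop :=
  forall n : nat, exists a b c d : nat,
    A a = true /\ A b = true /\ A c = true /\ A d = true /\ n = (a * b + c * d)%nat.

(* A(X) = |A ∩ [1, X]| for real X.  The naturals n with 1 <= n <= X all lie in
   seq 1 (Z.to_nat (up X)) = [1, ..., up X], since up X > X. *)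
Definition Acount (A : nat -> bool) (X : R) : nat :=
  length (filter (fun n => andb (A n) (if Rle_dec (INR n) X then true else false))
                 (seq 1 (Z.to_nat (up X)))).

(* Main.v *)
(* The multiplicative input: let a prime be odd if an odd number of primes
   precede it.  Every y factors as y1 * y2 with y1 a product of odd primes and y2
   a product of the other primes, and each of these two semigroups has
   O(x / sqrt(log x)) elements up to x.  Indeed if L1, L2 are the sums of 1/m over
   their elements m <= x, unique factorization gives L1 * L2 <= 1 + log (x^2), the
   interlacing of the two sets of primes gives L1 <= L2 <= 2 L1, hence both are
   O(sqrt(log x)); Chebyshev's bound turns this into a bound for the counts.

   The additive input: with h(j) ~ sqrt(j) a power of 2, A contains the numbers
   2^j y with y in one of the two semigroups and y <= 4 * 2^j h(j).  Products of
   two such elements give all 2^k y with y < 2^k h(k), so the intervals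
   [4^k h(k), 4^k h(k) + 2^(k+1)) in A supply all the missing residues mod 2^(k+1). *)

Require Import Defs.
From Stdlib Require Import Reals Lra ZArith.
From mathcomp Require Import all_boot zify.

Set Implicit Arguments.
Unset Strict Implicit.
Unset Printing Implicit Defensive.

Local Open Scope nat_scope.

(** * Harmonic sums over the two semigroups *)

Lemma leq_sum_pred (I : Type) (r : seq I) (P Q : pred I) (F : I -> nat) :
  subpred P Q -> \sum_(i <- r | P i) F i <= \sum_(i <- r | Q i) F i.
Proof.
move=> sPQ; rewrite big_mkcond [leqRHS]big_mkcond; apply: leq_sum => i _.
by case: ifP => // /sPQ ->.
Qed.

Lemma sum_nat_ltn (n N : nat) (P : pred nat) (F : nat -> nat) : n <= N ->
  \sum_(1 <= i < n.+1 | P i) F i = \sum_(1 <= i < N.+1 | P i && (i <= n)) F i.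
Proof. by move=> ?; rewrite (@big_nat_widen _ _ _ 1 n.+1 N.+1). Qed.

Lemma leq_sum_range (m n : nat) (P : pred nat) (F : nat -> nat) : m <= n ->
  \sum_(1 <= i < m.+1 | P i) F i <= \sum_(1 <= i < n.+1 | P i) F i.
Proof.
move=> le_mn; rewrite (sum_nat_ltn _ _ le_mn).
by apply: leq_sum_pred => i /andP[].
Qed.

Lemma sum_multiples (d n : nat) (P : pred nat) (F : nat -> nat) : 0 < d ->
  \sum_(1 <= y < n.+1 | P y && (d %| y)) F y =
  \sum_(1 <= m < (n %/ d).+1 | P (m * d)) F (m * d).
Proof.
move=> d_gt0; elim: n => [|n IHn]; first by rewrite div0n !big_geq.
rewrite big_mkcond big_nat_recr //= -big_mkcond IHn (divnS _ d_gt0).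
case: (boolP (d %| n.+1)) => dv; last by rewrite andbF addn0.
have -> : n.+1 = (n %/ d).+1 * d by rewrite -[LHS](divnK dv) divnS // dv.
rewrite [RHS]big_mkcond /= [RHS]big_nat_recr //= -big_mkcond /=.
by rewrite andbT.
Qed.

(* [z] times the sum of 1/m, with each term rounded down so as to stay in [nat];
   note that [pi.-nat 0] is false. *)
Definition harm (pi : nat_pred) (z : nat) :=
  \sum_(1 <= m < z.+1 | pi.-nat m) z %/ m.

Lemma harm_monor pi z1 z2 : z1 <= z2 -> harm pi z1 <= harm pi z2.
Proof.
move=> le_z; apply: leq_trans (leq_sum_range _ _ le_z).
by apply: leq_sum => m _; apply: leq_div2r.
Qed.

Lemma harm_monol (pi rho : nat_pred) z : {subset pi <= rho} ->
  harm pi z <= harm rho z.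
Proof.
move=> sub; apply: leq_sum_pred => m.
by apply: sub_in_pnat => p _; apply: sub.
Qed.

Lemma eq_harm (pi rho : nat_pred) z : pi =i rho -> harm pi z = harm rho z.
Proof. by move=> eq_pi; apply: eq_bigl => m; apply: eq_pnat. Qed.

Lemma harm_ge pi z : z <= harm pi z.
Proof.
case: z => [|z] //.
by rewrite /harm big_ltn_cond //= divn1 leq_addr.
Qed.

Lemma pnat_predU1 (pi : nat_pred) p m : prime p -> p \notin pi -> 0 < m ->
  ([predU1 p & pi] : nat_pred).-nat m && ~~ (p %| m) = pi.-nat m.
Proof.
move=> p_pr npi m_gt0; apply/andP/(pnatP _ m_gt0) => [[/(pnatP _ m_gt0) Hm ndv]|Hm].
  move=> q q_pr qm; have := Hm q q_pr qm; rewrite !inE => /orP[/eqP eqp|//].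
  by rewrite eqp in qm; rewrite qm in ndv.
split.
  by apply/(pnatP _ m_gt0) => q q_pr qm; rewrite !inE (Hm q q_pr qm) orbT.
by apply: contra npi => /(Hm p p_pr).
Qed.

(** Split off the multiples m = p m' of p: z %/ (p m') equals (z %/ p) %/ m' exactly, so the
    rounding costs nothing. *)
Lemma harm_predU1 (pi : nat_pred) p z : prime p -> p \notin pi ->
  harm [predU1 p & pi] z = harm pi z + harm [predU1 p & pi] (z %/ p).
Proof.
move=> p_pr npi; rewrite {1}/harm (bigID (fun m => p %| m)) /= addnC; congr (_ + _).
  apply: congr_big_nat => // m /andP[m_gt0 _].
  exact: pnat_predU1.
rewrite sum_multiples ?prime_gt0 //; apply: eq_big => m.
  by rewrite pnatM (pnatE _ p_pr) !inE eqxx andbT.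
by move=> _; rewrite mulnC divnMA.
Qed.

(** Unrolling both sides by [harm_predU1] leaves the arguments [z %/ q <= z %/ p], to which strong
    induction on z applies: the smaller prime gives the larger sum. *)
Lemma harm_predU1_le (pi rho : nat_pred) p q z : prime p -> prime q -> p <= q ->
    p \notin rho -> q \notin pi -> (forall z, harm pi z <= harm rho z) ->
  harm [predU1 q & pi] z <= harm [predU1 p & rho] z.
Proof.
move=> p_pr q_pr le_pq nrho npi le_h.
elim/ltn_ind: z => -[_|z IHz]; first by rewrite /harm big_geq.
rewrite (harm_predU1 z.+1 q_pr) // (harm_predU1 z.+1 p_pr) // leq_add //.
apply: leq_trans (IHz _ _) _; first by rewrite ltn_Pdiv ?prime_gt1.
by apply: harm_monor; rewrite leq_div2l ?prime_gt0.
Qed.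

(** The powers of 2 contribute the factor 1 + 1/2 + 1/4 + ... <= 2; in rounded form the induction
    rests on [2 * harm pi (z %/ 2) <= harm pi z]. *)
Lemma harm_add2 (pi : nat_pred) z : 2 \notin pi ->
  harm [predU1 2 & pi] z <= 2 * harm pi z.
Proof.
move=> npi; elim/ltn_ind: z => -[_|z IHz]; first by rewrite /harm big_geq.
rewrite harm_predU1 // mul2n -addnn leq_add2l.
apply: leq_trans (IHz _ _) _; first by rewrite ltn_Pdiv.
rewrite big_distrr /=.
apply: leq_trans (leq_sum_range _ _ (leq_div z.+1 2)).
by apply: leq_sum => m _; rewrite -divnMA [X in _ %/ X]mulnC divnMA mulnC leq_trunc_div.
Qed.

(** Defined at every integer, not only at primes, so that the interlacing argument can move its
    starting point one integer at a time. *)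
Definition primepar (p : nat) : bool := odd (\sum_(0 <= i < p) prime i).

Definition primecls (b : bool) (a N : nat) : nat_pred :=
  [pred p | prime p && (a <= p < N) && (primepar p == b)].

Lemma primeparS a : primepar a.+1 = primepar a (+) prime a.
Proof. by rewrite /primepar big_nat_recr //= oddD oddb. Qed.

(* Of the primes in [a, N), the class of parity [b] contains the first one; each of
   the two inequalities at [a] follows from the other one at [a.+1]. *)
Lemma harm_primecls (a N : nat) (b := primepar a) : a <= N ->
  (forall z, harm (primecls (~~ b) a N) z <= harm (primecls b a N) z) /\
  (forall p z, prime p -> p < a ->
     harm (primecls b a N) z <= harm [predU1 p & primecls (~~ b) a N] z).
Proof.
rewrite /b {b} => /subnKC <-; move: (N - a) => {N} n.
elim: n a => [|n IHn] a.
  have sub c rho : {subset primecls c a (a + 0) <= rho}.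
    by move=> q; rewrite !inE addn0; case/andP=> [/andP[_ /andP[]]]; lia.
  by split=> [z|p z _ _]; apply: harm_monol; apply: sub.
have [IH1 IH2] := IHn a.+1; rewrite addSnnS in IH1 IH2.
have a_lt : a < a + n.+1 by lia.
move: (a + n.+1) a_lt => N a_lt in IH1 IH2 *.
have skip c q : prime q -> (q \in primecls c a.+1 N) = (q \in primecls c a N) && (q != a).
  by move=> q_pr; rewrite !inE q_pr /=; case: (primepar q == c); lia.
case: (boolP (prime a)) => a_pr.
  have parS : primepar a.+1 = ~~ primepar a by rewrite primeparS a_pr addbT.
  rewrite parS in IH1 IH2; rewrite negbK in IH1 IH2.
  have clsN : primecls (~~ primepar a) a N =i primecls (~~ primepar a) a.+1 N.
    move=> q; rewrite !inE; case: (eqVneq q a) => [->|]; last by lia.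
    by case: (primepar a); rewrite ?andbF.
  have clsU : primecls (primepar a) a N =i [predU1 a & primecls (primepar a) a.+1 N].
    move=> q; rewrite !inE; case: (eqVneq q a) => [->|]; last by lia.
    by rewrite a_pr a_lt leqnn eqxx.
  have nina c : a \notin primecls c a.+1 N by rewrite !inE ltnn andbF.
  split=> [z|p z p_pr lt_pa].
    by rewrite (eq_harm z clsN) (eq_harm z clsU); apply: IH2.
  rewrite (eq_harm z clsU).
  (* Trading a for the smaller prime p can only enlarge the sum; the primes after a are compared by
     [IH1]. *)
  apply: leq_trans (harm_predU1_le z p_pr a_pr (ltnW lt_pa) _ _ IH1) _ => //.
    by rewrite !inE; lia.
  apply: harm_monol => q; rewrite inE [in X in _ -> X]inE /= => /orP[-> //|].
  by rewrite clsN => ->; rewrite orbT.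
have parS : primepar a.+1 = primepar a by rewrite primeparS (negbTE a_pr) addbF.
have clsE c : primecls c a N =i primecls c a.+1 N.
  move=> q; rewrite !inE; case: (eqVneq q a) => [->|]; last by lia.
  by rewrite (negbTE a_pr).
rewrite parS in IH1 IH2.
split=> [z|p z p_pr lt_pa]; first by rewrite !(eq_harm z (clsE _)).
rewrite (eq_harm z (clsE _)).
apply: leq_trans (IH2 p z p_pr (leqW lt_pa)) _.
apply: harm_monol => q; rewrite inE [in X in _ -> X]inE /= => /orP[-> //|].
by rewrite -clsE => ->; rewrite orbT.
Qed.

Definition oddprimes : nat_pred := [pred p | primepar p].

Lemma harm_cls z b : let pi : nat_pred := [pred p | primepar p == b] in
  harm pi z = harm (primecls b 0 z.+1) z.
Proof.
apply: congr_big_nat => // m /andP[m_gt0 m_le]; apply: eq_in_pnat => p.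
rewrite mem_primes !inE => /and3P[p_pr _ /(dvdn_leq m_gt0) ?].
by rewrite p_pr /=; case: (primepar p == b); lia.
Qed.

(** Interlacing from 0, where the class of 2 comes first, gives the left inequality. Interlacing
    from 3 reverses the roles, and putting 2 back costs a factor 2. *)
Lemma harm_oddprimes z :
  harm oddprimes z <= harm oddprimes^' z <= 2 * harm oddprimes z.
Proof.
have -> : harm oddprimes z = harm (primecls true 0 z.+1) z.
  by rewrite -harm_cls; apply: eq_harm => p; rewrite !inE eqb_id.
have -> : harm oddprimes^' z = harm (primecls false 0 z.+1) z.
  by rewrite -harm_cls; apply: eq_harm => p; rewrite !inE eqbF_neg.
have par0 : primepar 0 = false by rewrite /primepar big_geq.
have par2 : primepar 2 = false by rewrite !primeparS par0.
have par3 : primepar 3 = true by rewrite primeparS par2.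
have [H _] := harm_primecls (leq0n z.+1); rewrite par0 in H; rewrite H /=.
have [le3z|] := leqP 3 z.+1; last first.
  case: z H => [|[|z]] // _ _; first by rewrite /harm big_geq.
  by rewrite {1}/harm big_ltn_cond //= big_geq // /harm big_ltn_cond.
have [{}H _] := harm_primecls le3z; rewrite par3 /= in H.
have eq2 : primecls false 0 z.+1 =i [predU1 2 & primecls false 3 z.+1].
  move=> p; rewrite !inE; case: (eqVneq p 2) => [->|ne].
    by rewrite par2 (_ : prime 2 = true) //; lia.
  case: (boolP (prime p)) => // /prime_gt1 p_gt1.
  have -> : 2 < p by rewrite ltn_neqAle eq_sym ne.
  by [].
rewrite (eq_harm z eq2); apply: leq_trans (harm_add2 _ _) _.
  by rewrite !inE par2.
rewrite leq_mul2l; apply: leq_trans (H z) _; apply: harm_monol => p.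
by rewrite !inE; case: (primepar p); lia.
Qed.

(* Unique factorization: a product m1 * m2 determines its [pi]-part m1. *)
Lemma harm_mul_le (pi : nat_pred) z :
  harm pi z * harm pi^' z <= \sum_(1 <= y < (z ^ 2).+1) z ^ 2 %/ y.
Proof.
rewrite /harm big_distrlr /=.
rewrite -!(big_filter (index_iota 1 z.+1)).
under eq_bigr do rewrite -(big_filter (index_iota 1 z.+1)).
set r1 := [seq m <- _ | _]; set r2 := [seq m <- _ | _].
pose s := [seq m1 * m2 | m1 <- r1, m2 <- r2].
have s_uniq : uniq s.
  apply: allpairs_uniq; rewrite ?filter_uniq ?iota_uniq //.
  move=> x y /allpairsP[[a1 a2] /= [a1r a2r ->]] /allpairsP[[b1 b2] /= [b1r b2r ->]].
  move: a1r a2r b1r b2r; rewrite !mem_filter !mem_index_iota.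
  move=> /and3P[pa1 a1_gt0 _] /and3P[pa2 a2_gt0 _] /and3P[pb1 b1_gt0 _] /and3P[pb2 b2_gt0 _] eqab.
  have part1 a b : pi.-nat a -> pi^'.-nat b -> 0 < a -> 0 < b -> (a * b)`_pi = a.
    by move=> *; rewrite partnM // part_pnat_id // part_p'nat // muln1.
  have eq1 : a1 = b1 by rewrite -(part1 a1 a2) // eqab part1.
  rewrite eq1 in eqab *; congr (_, _).
  by apply/eqP; rewrite -(eqn_pmul2l b1_gt0) eqab.
have s_sub y : y \in s -> y \in index_iota 1 (z ^ 2).+1.
  case/allpairsP=> [[a1 a2] /= [a1r a2r ->]].
  move: a1r a2r; rewrite !mem_filter !mem_index_iota.
  by move=> /and3P[_ ? ?] /and3P[_ ? ?]; rewrite muln_gt0; apply/andP; split; nia.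
apply: (@leq_trans (\sum_(y <- s) z ^ 2 %/ y)).
  rewrite /s big_allpairs_dep /=; apply: leq_sum => m1 _; apply: leq_sum => m2 _.
  have [->|m1_gt0] := posnP m1; first by rewrite divn0.
  have [->|m2_gt0] := posnP m2; first by rewrite divn0 muln0.
  rewrite leq_divRL ?muln_gt0 ?m1_gt0 // mulnACA -mulnn.
  by rewrite leq_mul ?leq_trunc_div.
have -> : \sum_(y <- s) z ^ 2 %/ y =
    \sum_(y <- index_iota 1 (z ^ 2).+1 | y \in s) z ^ 2 %/ y.
  rewrite -[RHS]big_filter; apply/perm_big/uniq_perm => //.
    by rewrite filter_uniq ?iota_uniq.
  by move=> y; rewrite mem_filter; case: (boolP (y \in s)) => // /s_sub ->.
exact: leq_sum_pred.
Qed.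

(** Each of the w dyadic ranges of y contributes at most 2^v. *)
Lemma sum_divn_pow2 (v w : nat) :
  \sum_(1 <= y < 2 ^ w) 2 ^ v %/ y <= w * 2 ^ v.
Proof.
elim: w => [|w IHw]; first by rewrite big_geq.
have le2w : 2 ^ w <= 2 ^ w.+1 by rewrite leq_exp2l.
rewrite (big_cat_nat (expn_gt0 2 w) le2w) /= mulSn addnC leq_add //.
apply: (@leq_trans (\sum_(2 ^ w <= y < 2 ^ w.+1) 2 ^ v %/ 2 ^ w)).
  rewrite big_nat [leqRHS]big_nat; apply: leq_sum => y /andP[le_wy _].
  by rewrite leq_div2l ?expn_gt0.
rewrite sum_nat_const_nat expnS mul2n -addnn addnK mulnC.
exact: leq_trunc_div.
Qed.

(** With L1 <= L2 <= 2 L1 and L1 L2 <= 2 (u+1) 4^u, both squares are at most 2 L1 L2. *)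
Lemma harm_sqr (u : nat) (pi := oddprimes) :
  harm pi (2 ^ u) ^ 2 <= 4 ^ u.+1 * u.+1 /\
  harm pi^' (2 ^ u) ^ 2 <= 4 ^ u.+1 * u.+1.
Proof.
have /andP[H1 H2] := harm_oddprimes (2 ^ u).
have := harm_mul_le pi (2 ^ u).
have sq : (2 ^ u) ^ 2 = 4 ^ u by rewrite -expnM mulnC expnM.
have le : \sum_(1 <= y < ((2 ^ u) ^ 2).+1) (2 ^ u) ^ 2 %/ y <= 2 * u.+1 * 4 ^ u.
  have := sum_divn_pow2 (2 * u) (2 * u).+1.
  rewrite (expnM 2 2 u) (_ : 2 ^ 2 = 4) // -sq => H.
  apply: leq_trans (leq_trans H _); last by rewrite leq_mul2r; lia.
  have le1 : (2 ^ u) ^ 2 < 2 ^ (2 * u).+1.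
    by rewrite sq expnS expnM mul2n -addnn -ltn_subLR ?subnn ?expn_gt0.
  rewrite -(prednK (expn_gt0 2 (2 * u).+1)); apply: leq_sum_range.
  by rewrite -ltnS prednK ?expn_gt0.
move=> /leq_trans /(_ le); rewrite -!mulnn expnS -/pi.
move: (harm pi (2 ^ u)) (harm pi^' (2 ^ u)) (4 ^ u) H1 H2 => a b c H1 H2 H.
split; nia.
Qed.

(** * Chebyshev's bound *)

Lemma prod_primes_dvd (s : seq nat) (N : nat) : uniq s ->
  {in s, forall p, prime p && (p %| N)} -> \prod_(p <- s) p %| N.
Proof.
elim: s => [|p s IHs] /=; first by rewrite big_nil dvd1n.
case/andP=> nps s_uniq Hs; rewrite big_cons.
have /andP[p_pr p_dv] := Hs p (mem_head _ _).
have Hs' : {in s, forall q, prime q && (q %| N)}.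
  by move=> q qs; apply: Hs; rewrite inE qs orbT.
rewrite Gauss_dvd ?p_dv ?IHs //.
rewrite prime_coprime // Euclid_dvd_prod // big_has; apply/hasPn => q qs.
have /andP[q_pr _] := Hs' q qs.
by rewrite dvdn_prime2 //; apply: contraNneq nps => ->.
Qed.

Lemma prime_dvd_fact p k : prime p -> (p %| k`!) = (p <= k).
Proof.
move=> p_pr; apply/idP/idP => [|le_pk]; last by rewrite dvdn_fact ?prime_gt0.
elim: k => [|k IHk]; first by rewrite fact0 dvdn1 => /eqP p1; rewrite p1 in p_pr.
by rewrite factS Euclid_dvdM // => /orP[/dvdn_leq->|/IHk/leqW].
Qed.

(** The two equal middle coefficients both occur in the expansion of (1 + 1)^(2m+1) = 2 * 4^m. *)
Lemma bin_odd_le m : 'C(m.*2.+1, m) <= 4 ^ m.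
Proof.
have := expnDn 1 1 m.*2.+1; rewrite expnS -mul2n expnM.
under eq_bigr do rewrite !exp1n !muln1.
have lt1 : m < (2 * m).+2 by lia.
have lt2 : m.+1 < (2 * m).+2 by lia.
rewrite (bigD1 (Ordinal lt1)) //= (bigD1 (Ordinal lt2)) /=; last first.
  by rewrite -val_eqE /= neq_ltn ltnSn orbT.
rewrite -(@bin_sub _ m); last by lia.
have -> : (2 * m).+1 - m = m.+1 by lia.
rewrite (_ : (1 + 1) ^ 2 = 4) //.
move: (binomial _ _) (4 ^ m) (\sum_(_ | _) _) => a b c; lia.
Qed.

(** Erdős's argument: for n = 2m+1 the primes in [m+2, 2m+1] all divide C(2m+1, m) <= 4^m, and
    induction handles those up to m+1. *)
Lemma primorial_le n : \prod_(1 <= p < n.+1 | prime p) p <= 4 ^ n.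
Proof.
elim/ltn_ind: n => n IHn.
case: n IHn => [|n] IHn; first by rewrite big_geq.
case: (boolP (prime n.+1)) => n_pr; last first.
  rewrite big_mkcond big_nat_recr //= -big_mkcond (negbTE n_pr) muln1.
  by apply: leq_trans (IHn n _) _ => //; rewrite leq_exp2l.
case: (even_prime n_pr) => [[->]|n_odd].
  by rewrite unlock.
pose m := n./2.
have n_eq : n = m.*2 by rewrite -[LHS]odd_double_half; move: n_odd => /=; case: (odd n).
have m_gt0 : 0 < m by move: (prime_gt1 n_pr); lia.
rewrite n_eq in n_pr *.
have le1 : m.+2 <= m.*2.+2 by lia.
rewrite (big_cat_nat _ le1) //=.
have -> : 4 ^ m.*2.+1 = 4 ^ m.+1 * 4 ^ m by rewrite -expnD; congr (4 ^ _); lia.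
apply: leq_mul; first by apply: IHn; lia.
apply: leq_trans (bin_odd_le m).
apply: dvdn_leq; first by rewrite bin_gt0; lia.
rewrite -big_filter; apply: prod_primes_dvd; first by rewrite filter_uniq ?iota_uniq.
move=> p; rewrite mem_filter mem_index_iota => /and3P[p_pr ge_p lt_p].
rewrite p_pr /=.
have : p %| 'C(m.*2.+1, m) * (m`! * (m.*2.+1 - m)`!).
  by rewrite bin_fact ?dvdn_fact; lia.
rewrite !Euclid_dvdM // !prime_dvd_fact // => /or3P[//| |]; lia.
Qed.

Lemma theta_le n : \sum_(1 <= p < n.+1 | prime p) trunc_log 2 p <= 2 * n.
Proof.
rewrite -(@leq_exp2l 2) // expnM (_ : 2 ^ 2 = 4) //.
apply: leq_trans (primorial_le n); rewrite expn_sum.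
by apply: leq_prod => p /prime_gt0 p_gt0; apply: trunc_logP.
Qed.

(** * Counting the two semigroups *)

Lemma sum_leq_le (l X : nat) (P : pred nat) :
  \sum_(1 <= a < X.+1 | P a) (a <= l) <= l.
Proof.
apply: (@leq_trans (\sum_(1 <= a < X.+1) (a <= l))).
  exact: leq_sum_pred.
elim: X => [|X IHX]; first by rewrite big_geq.
rewrite big_nat_recr //=; case: (leqP X.+1 l) => [leX|_]; last by rewrite addn0.
rewrite addn1; apply: leq_trans leX; rewrite ltnS.
apply: (@leq_trans (\sum_(1 <= a < X.+1) 1)).
  by apply: leq_sum => a _; case: (a <= l).
by rewrite sum_nat_const_nat subn1 muln1.
Qed.

(* The second summand bounds the proper powers of [p]: they only occur for
   p <= sqrt z, and contribute at most log z each. *)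
Lemma psi_term p z X : prime p ->
  (trunc_log 2 p).+1 * \sum_(1 <= a < X.+1) (p ^ a <= z) <=
  2 * (trunc_log 2 p * (p <= z)) + 2 * (trunc_log 2 z * (p ^ 2 <= z)).
Proof.
move=> p_pr; have p_gt1 := prime_gt1 p_pr.
have [->|z_gt0] := posnP z.
  rewrite big1 ?muln0 // => a _.
  by rewrite leqn0 expn_eq0 -leqn0 leqNgt (prime_gt0 p_pr).
have [lz1 lz2] := andP (trunc_log_bounds p_gt1 z_gt0).
set l := trunc_log p z in lz1 lz2.
have le_l : \sum_(1 <= a < X.+1) (p ^ a <= z) <= l.
  apply: leq_trans (sum_leq_le l X xpredT).
  apply: leq_sum => a _; case: (leqP (p ^ a) z) => // le_az.
  by rewrite (trunc_log_max p_gt1 le_az).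
have lgp : 0 < trunc_log 2 p by rewrite trunc_log_gt0.
apply: leq_trans (leq_mul (leqnn _) le_l) _.
have : (trunc_log 2 p).+1 * l <= 2 * (trunc_log 2 p * l).
  by rewrite mulnA leq_mul2r; lia.
move=> /leq_trans; apply; rewrite -mulnDr leq_mul2l /=.
case: (leqP (p ^ 2) z) => [_|lt_zp2].
  rewrite muln1; apply: leq_trans (leq_addl _ _).
  apply: trunc_log_max => //; rewrite expnM; apply: leq_trans lz1.
  by case: (l) => [|l'] //; rewrite leq_exp2r // trunc_logP // prime_gt0.
have l_le1 : l <= 1.
  by rewrite -ltnS -(ltn_exp2l _ _ p_gt1); apply: leq_ltn_trans lz1 lt_zp2.
case: (leqP p z) => [_|lt_zp]; first by rewrite muln0 addn0 leq_mul2l l_le1 orbT.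
suff -> : l = 0 by rewrite muln0.
apply/eqP; rewrite -leqn0 -ltnS -(ltn_exp2l _ _ p_gt1).
by apply: leq_ltn_trans lz1 _; rewrite expn1.
Qed.

(** Chebyshev's bound for psi, with rounded logarithms: [theta_le] accounts for 4z, and the proper
    prime powers for 8z. *)
Lemma psi_le X z : z <= X ->
  \sum_(1 <= p < X.+1 | prime p)
    (trunc_log 2 p).+1 * \sum_(1 <= a < X.+1) (p ^ a <= z) <= 12 * z.
Proof.
move=> le_zX.
apply: (@leq_trans (\sum_(1 <= p < X.+1 | prime p)
    (2 * (trunc_log 2 p * (p <= z)) + 2 * (trunc_log 2 z * (p ^ 2 <= z))))).
  by apply: leq_sum => p; apply: psi_term.
rewrite big_split /= -!big_distrr /=.
have -> : \sum_(1 <= p < X.+1 | prime p) trunc_log 2 p * (p <= z) =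
          \sum_(1 <= p < z.+1 | prime p) trunc_log 2 p.
  rewrite (sum_nat_ltn _ _ le_zX) [RHS]big_mkcondr /=.
  by apply: eq_bigr => p _; case: (p <= z); rewrite ?muln1 ?muln0.
have := theta_le z.
suff : trunc_log 2 z * \sum_(1 <= p < X.+1 | prime p) (p ^ 2 <= z) <= 4 * z by lia.
have [->|z_gt0] := posnP z; first by rewrite trunc_log0.
have /andP[] := trunc_log_bounds (isT : 1 < 2) z_gt0.
set w := trunc_log 2 z => le_wz lt_zw.
have w_eq := odd_double_half w; set v := w./2 in w_eq.
(* A prime with p^2 <= z < 2^(w+1) is at most 2^(v+1), because w + 1 <= 2(v + 1). *)
apply: (@leq_trans (w * 2 ^ v.+1)).
  rewrite leq_mul2l; apply/orP; right.
  apply: leq_trans (sum_leq_le (2 ^ v.+1) X prime).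
  apply: leq_sum => p _; case: (leqP (p ^ 2) z) => // le_pz.
  suff -> : p <= 2 ^ v.+1 by [].
  rewrite -(leq_exp2r _ _ (isT : 0 < 2)); apply: leq_trans le_pz _.
  apply: leq_trans (ltnW lt_zw) _; rewrite -expnM leq_exp2l //.
  by case: (odd w) w_eq; lia.
apply: leq_trans (leq_mul (leqnn 4) le_wz).
have lt_v : v < 2 ^ v by apply: ltn_expl.
apply: (@leq_trans (4 * (2 ^ v * 2 ^ v))).
  by rewrite expnS; move: lt_v; set e := 2 ^ v; case: (odd w) w_eq; nia.
by rewrite -expnD leq_mul2l leq_exp2l //; lia.
Qed.

(** A rounded form of log y = sum of v_p(y) log p: the left side rounds down and each weight on the
    right rounds up. *)
Lemma trunc_log_le_logn y X : 0 < y <= X ->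
  trunc_log 2 y <=
    \sum_(1 <= p < X.+1 | prime p) (trunc_log 2 p).+1 * logn p y.
Proof.
case/andP=> y_gt0 le_yX; rewrite -(@leq_exp2l 2) //.
apply: leq_trans (trunc_logP _ y_gt0) _ => //.
rewrite -{1}(partnT y_gt0) (widen_partn _ le_yX) big_ltn_cond //=.
rewrite mul1n expn_sum [leqRHS]big_mkcond; apply: leq_prod => p _.
case: (boolP (prime p)) => p_pr; last by rewrite lognE (negbTE p_pr).
rewrite expnM; case: (logn p y) => // k.
by rewrite leq_exp2r // ltnW // trunc_log_ltn.
Qed.

Definition pcount (pi : nat_pred) (z : nat) := \sum_(1 <= m < z.+1 | pi.-nat m) 1.

(* Expand log y over the prime powers p^a | y and write y = p^a * m: what remains is a
   sum of Chebyshev's psi (X / m) over m. *)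
Lemma sum_trunc_log_le (pi : nat_pred) X :
  \sum_(1 <= y < X.+1 | pi.-nat y) trunc_log 2 y <= 12 * harm pi X.
Proof.
pose up p := (trunc_log 2 p).+1.
apply: (@leq_trans (\sum_(1 <= y < X.+1 | pi.-nat y)
    \sum_(1 <= p < X.+1 | prime p) up p * \sum_(1 <= a < X.+1) (p ^ a %| y))).
  rewrite big_nat_cond [leqRHS]big_nat_cond; apply: leq_sum => y /andP[/andP[y_gt0 le_yX] _].
  apply: leq_trans (@trunc_log_le_logn y X _) _; first by rewrite y_gt0.
  apply: leq_sum => p p_pr; rewrite leq_mul2l; apply/orP; right.
  rewrite logn_count_dvd // -(prednK y_gt0).
  by apply: leq_sum_range; lia.
rewrite exchange_big /= /harm big_distrr /=.
apply: (@leq_trans (\sum_(1 <= m < X.+1 | pi.-nat m)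
    \sum_(1 <= p < X.+1 | prime p) up p * \sum_(1 <= a < X.+1) (p ^ a <= X %/ m))).
  rewrite [leqRHS]exchange_big /=; apply: leq_sum => p p_pr.
  rewrite -!big_distrr leq_mul2l /=.
  rewrite exchange_big [leqRHS]exchange_big /=; apply: leq_sum => a _.
  have pa_gt0 : 0 < p ^ a by rewrite expn_gt0 prime_gt0.
  have -> : \sum_(1 <= y < X.+1 | pi.-nat y) (p ^ a %| y) =
            \sum_(1 <= y < X.+1 | pi.-nat y && (p ^ a %| y)) 1.
    by rewrite [RHS]big_mkcondr /=; apply: eq_bigr => y _; case: (_ %| _).
  rewrite sum_multiples //=.
  rewrite (sum_nat_ltn _ _ (leq_div X (p ^ a))) big_nat_cond [leqRHS]big_nat_cond.
  rewrite [leqRHS]big_mkcond [leqLHS]big_mkcond; apply: leq_sum => m _.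
  case: ifP => // /andP[m_range /andP[]]; rewrite pnatM => /andP[pm _].
  rewrite leq_divRL // mulnC => le_X; case/andP: (m_range) => m_gt0 _.
  by rewrite m_range pm /= leq_divRL // le_X.
apply: leq_sum => m _; apply: psi_le; exact: leq_div.
Qed.

(** From u to u+1 every old deficit grows by at most 1 and the 2^u new terms have deficit at most
    1. *)
Lemma sum_log_deficit u : \sum_(1 <= y < 2 ^ u) (u - trunc_log 2 y) <= 2 ^ u.+1.
Proof.
elim: u => [|u IHu]; first by rewrite big_geq.
have le2 : 2 ^ u <= 2 ^ u.+1 by rewrite leq_exp2l.
rewrite (big_cat_nat (expn_gt0 2 u) le2) /=.
apply: (@leq_trans (\sum_(1 <= y < 2 ^ u) ((u - trunc_log 2 y) + 1) +
                    \sum_(2 ^ u <= y < 2 ^ u.+1) 1)).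
  apply: leq_add; first by apply: leq_sum => y _; lia.
  rewrite big_nat_cond [leqRHS]big_nat_cond; apply: leq_sum => y /andP[/andP[le_y _] _].
  by have := trunc_log_max (isT : 1 < 2) le_y; lia.
rewrite big_split /= !sum_nat_const_nat !muln1 in IHu *.
by move: IHu (expn_gt0 2 u); rewrite !expnS; lia.
Qed.

(** Write u = (u - log y) + log y and sum over the semigroup. The deficits give at most 2 * 2^u <= 2
    [harm], the logarithms at most 12 [harm]. *)
Lemma pcount_harm (pi : nat_pred) u : pcount pi (2 ^ u) * u <= 14 * harm pi (2 ^ u).
Proof.
have := sum_trunc_log_le pi (2 ^ u); have := harm_ge pi (2 ^ u).
suff : pcount pi (2 ^ u) * u <= 2 ^ u.+1 +
    \sum_(1 <= y < (2 ^ u).+1 | pi.-nat y) trunc_log 2 y.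
  by rewrite expnS; lia.
apply: leq_trans (leq_add (sum_log_deficit u) (leqnn _)).
apply: (@leq_trans (\sum_(1 <= y < (2 ^ u).+1 | pi.-nat y)
    ((u - trunc_log 2 y) + trunc_log 2 y))).
  by rewrite /pcount big_distrl /=; apply: leq_sum => y _; lia.
rewrite big_split /= leq_add2r.
apply: (@leq_trans (\sum_(1 <= y < (2 ^ u).+1) (u - trunc_log 2 y))).
  exact: leq_sum_pred.
by rewrite big_nat_recr ?expn_gt0 //= trunc_expnK // subnn addn0.
Qed.

(** Square [pcount_harm] and insert the bound on [harm]. Replacing u by u+1 costs (u+1)^2 <= 4 u^2
    for u >= 1, whence 56^2 = 14^2 * 4 * 4. *)
Lemma pcount_sqr (pi : nat_pred) u : harm pi (2 ^ u) ^ 2 <= 4 ^ u.+1 * u.+1 ->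
  pcount pi (2 ^ u) ^ 2 * u.+1 <= 56 ^ 2 * 4 ^ u.
Proof.
case: u => [_|u le_h].
  by rewrite /pcount big_ltn_cond //= big_geq.
have := pcount_harm pi (2 ^ 0 * u.+1); rewrite mul1n.
set P := pcount _ _; set H := harm _ _ in le_h * => le_P.
have le1 : (P * u.+1) ^ 2 <= 14 ^ 2 * (4 ^ u.+2 * u.+2).
  apply: (@leq_trans ((14 * H) ^ 2)); first by rewrite leq_exp2r.
  by rewrite expnMn leq_mul2l le_h orbT.
rewrite -(@leq_pmul2r (u.+1 ^ 2)); last by rewrite expn_gt0.
have le2 : u.+2 ^ 2 <= 4 * u.+1 ^ 2.
  by rewrite (_ : 4 = 2 ^ 2) // -expnMn leq_exp2r //; lia.
have -> : P ^ 2 * u.+2 * u.+1 ^ 2 = (P * u.+1) ^ 2 * u.+2 by rewrite expnMn; lia.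
apply: leq_trans (leq_mul le1 (leqnn _)) _.
have -> : 14 ^ 2 * (4 ^ u.+2 * u.+2) * u.+2 = 14 ^ 2 * 4 ^ u.+2 * u.+2 ^ 2 by lia.
apply: leq_trans (leq_mul (leqnn _) le2) _.
rewrite [4 ^ u.+2]expnS; move: (u.+1 ^ 2) (4 ^ u.+1) => a b.
rewrite (_ : 14 ^ 2 = 196) // (_ : 56 ^ 2 = 3136) //; lia.
Qed.

Lemma pcount_oddprimes u (pi := oddprimes) :
  (pcount pi (2 ^ u) + pcount pi^' (2 ^ u)) ^ 2 * u.+1 <= 112 ^ 2 * 4 ^ u.
Proof.
have [/pcount_sqr + /pcount_sqr] := harm_sqr u.
move: (pcount _ _) (pcount _ _) => a b.
rewrite (_ : 112 ^ 2 = 4 * 56 ^ 2) // -(mulnA 4).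
move: (56 ^ 2 * 4 ^ u) => c Ha Hb.
have [H _] := nat_Cauchy a b; rewrite sqrnD.
apply: (@leq_trans ((2 * (a ^ 2 + b ^ 2)) * u.+1)).
  by rewrite leq_mul2r; apply/orP; right; lia.
lia.
Qed.

(** * The set and its products *)

(* [2 ^ half_log k] is sqrt (k+1) up to a factor 2. *)
Definition half_log (k : nat) := (trunc_log 2 k.+1)./2.

Lemma half_log_bounds k : 4 ^ half_log k <= k.+1 < 4 ^ (half_log k).+1.
Proof.
have /andP[le lt] := trunc_log_bounds (isT : 1 < 2) (ltn0Sn k).
rewrite (_ : 4 = 2 ^ 2) // -!expnM /half_log; apply/andP; split.
  by apply: leq_trans le; rewrite leq_exp2l //; lia.
by apply: leq_trans lt _; rewrite leq_exp2l //; lia.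
Qed.

Lemma half_log_le k : 2 * half_log k <= k.
Proof.
have /andP[le _] := half_log_bounds k.
rewrite -ltnS -(ltn_exp2l _ _ (isT : 1 < 2)) expnM (_ : 2 ^ 2 = 4) // expnS.
by have := ltn_expl k (isT : 1 < 2); lia.
Qed.

Lemma leq_half_log k l : k < 4 * l.+1 -> half_log k <= (half_log l).+1.
Proof.
move=> lt_kl; have /andP[le _] := half_log_bounds k.
have /andP[_ lt] := half_log_bounds l.
by rewrite -ltnS -(ltn_exp2l _ _ (isT : 1 < 4)) expnS; lia.
Qed.

(** With h(k) = [2 ^ half_log k], [block k.+1] is 4^k h(k). The value 0 at k = 0 makes the ranges
    from [block k] to [block k.+1] cover all of the naturals. *)
Definition block (k : nat) := if k is k'.+1 then 2 ^ (2 * k' + half_log k') else 0.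

Lemma blockS_ge k : 2 ^ k <= block k.+1.
Proof. by rewrite leq_exp2l //; lia. Qed.

Lemma half_log_mono k l : k <= l -> half_log k <= half_log l.
Proof. by move=> le; apply/half_leq/leq_trunc_log. Qed.

Lemma block_mono k l : k <= l -> block k <= block l.
Proof.
case: k l => [|k] [|l] // le_kl; rewrite leq_exp2l //.
by have := half_log_mono (le_kl : k <= l); lia.
Qed.

Definition pure (y : nat) := oddprimes.-nat y || oddprimes^'.-nat y.

(** The bound on k makes membership boolean and loses nothing, since [block k <= n] forces k <=
    n+1. *)
Definition in_block (n : nat) :=
  [exists k : 'I_n.+2, block k <= n < block k + 2 ^ k].

Definition in_dilates (n : nat) :=
  [exists j : 'I_n.+1, (2 ^ j %| n) &&
     (let y := n %/ 2 ^ j in (y <= 2 ^ (j + half_log j + 2)) && pure y)].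

(** With 0 and 1 present, a block element is itself a product and the second product may vanish. *)
Definition basis (n : nat) := [|| n < 2, in_block n | in_dilates n].

Lemma mem_in_dilates j y : 0 < y -> y <= 2 ^ (j + half_log j + 2) -> pure y ->
  in_dilates (2 ^ j * y).
Proof.
move=> y_gt0 le_y py.
have lt_j : j < (2 ^ j * y).+1.
  by have := ltn_expl j (isT : 1 < 2); rewrite ltnS; nia.
apply/existsP; exists (Ordinal lt_j) => /=.
by rewrite dvdn_mulr //= mulKn ?expn_gt0 // le_y.
Qed.

Lemma pure_factorization y : 0 < y ->
  exists y1 y2, [/\ y = y1 * y2, 0 < y1 <= y2, pure y1 & pure y2].
Proof.
move=> y_gt0; have y_eq := partnC oddprimes y_gt0.
set y1 := y`_oddprimes in y_eq; set y2 := y`_oddprimes^' in y_eq.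
have p1 : pure y1 by rewrite /pure part_pnat.
have p2 : pure y2 by rewrite /pure part_pnat orbT.
have y1_gt0 : 0 < y1 by apply: part_gt0.
have y2_gt0 : 0 < y2 by apply: part_gt0.
case: (leqP y1 y2) => le12; first by exists y1, y2; rewrite y1_gt0.
by exists y2, y1; rewrite mulnC y2_gt0 ltnW.
Qed.

(* Taking i minimal with y1 <= 2^i for the smaller factor y1 keeps i <= 3k/4 + 1, so
   that [half_log (k - i)] is still close to [half_log k]. *)
Lemma dilates_cover k y : 0 < y < 2 ^ (k + half_log k) ->
  exists a b, [/\ in_dilates a, in_dilates b & 2 ^ k * y = a * b].
Proof.
case/andP=> y_gt0 lt_y.
have [y1 [y2 [y_eq /andP[y1_gt0 le12] p1 p2]]] := pure_factorization y_gt0.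
pose i := up_log 2 y1.
have le_y1 : y1 <= 2 ^ i := up_logP y1 (isT : 1 < 2).
have lt_i : 2 ^ i < 2 * y1.
  case: (leqP y1 1) => [y1_le1|y1_gt1].
    by rewrite /i (_ : y1 = 1) ?up_log1 //; lia.
  rewrite -[i]prednK ?up_log_gt0 // expnS ltn_pmul2l //.
  exact: up_log_gtn.
have le_e := half_log_le k; set e := half_log k in le_e lt_y.
have lt_2i : 2 * i < k + e + 2.
  rewrite -(ltn_exp2l _ _ (isT : 1 < 2)) mul2n -addnn expnD (expnD 2 (k + e)).
  apply: (@leq_ltn_trans (2 * y1 * (2 * y2))); first by apply: leq_mul; lia.
  by rewrite (_ : 2 ^ 2 = 4) // mulnACA -y_eq mulnC ltn_pmul2r.
have le_ik : i <= k by lia.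
exists (2 ^ i * y1), (2 ^ (k - i) * y2); split.
- apply: mem_in_dilates => //; apply: leq_trans le_y1 _.
  by rewrite leq_exp2l //; lia.
- apply: mem_in_dilates => //; first lia.
  (* From 2i < k + e + 2 and 2e <= k one gets k < 4(k - i + 1), so passing from k to k - i lowers
     [half_log] by at most 1. The exponent 2 in [in_dilates] absorbs this and the factor 2 from
     [lt_i]. *)
  have le_kj : k < 4 * (k - i).+1 by lia.
  have := leq_half_log le_kj; rewrite -/e => le_ej.
  apply: (@leq_trans (2 ^ (k - i + e + 1))); last by rewrite leq_exp2l //; lia.
  rewrite -(@leq_pmul2l (2 ^ i)) ?expn_gt0 // -expnD.
  have -> : i + (k - i + e + 1) = k + e + 1 by lia.
  apply: (@leq_trans (2 * y1 * y2)); first by rewrite leq_mul2r ltnW ?orbT.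
  by rewrite expnD expn1 -mulnA -y_eq mulnC leq_mul2r ltnW.
- by rewrite mulnACA -expnD subnKC // y_eq.
Qed.

Lemma block_cover n : exists k, block k <= n < block k.+1.
Proof.
have ex : exists k, block k <= n by exists 0.
have ub k : block k <= n -> k <= n.+1.
  case: k => // k le_n; rewrite ltnS; apply: leq_trans le_n.
  apply: leq_trans (blockS_ge k); exact/ltnW/ltn_expl.
case: (ex_maxnP ex ub) => k le_k max_k; exists k; rewrite le_k /=.
by rewrite ltnNge; apply/negP => le_n; have := max_k k.+1 le_n; rewrite ltnn.
Qed.

(** Divide n - [block k] by 2^k: the remainder moves the start of the block within its interval, and
    the quotient, being below 2^k h(k), is handled by [dilates_cover]. *)
Lemma basis_cover n : exists a b c d : nat,
  [/\ basis a, basis b, basis c, basis d & n = a * b + c * d].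
Proof.
have [k /andP[le_k lt_k]] := block_cover n.
pose r := n - block k.
have r_eq := divn_eq r (2 ^ k).
have c_in : basis (block k + r %% 2 ^ k).
  apply/orP; right; apply/orP; left.
  have lt1 : k < (block k + r %% 2 ^ k).+2.
    case: k {le_k lt_k r_eq} @r => // k r; have := blockS_ge k.
    by have := ltn_expl k (isT : 1 < 2); lia.
  by apply/existsP; exists (Ordinal lt1); rewrite /= leq_addr ltn_add2l ltn_pmod ?expn_gt0.
have n_eq : n = (block k + r %% 2 ^ k) * 1 + 2 ^ k * (r %/ 2 ^ k).
  by rewrite muln1 -addnA [_ %% _ + _]addnC [2 ^ k * _]mulnC -r_eq subnKC.
have [r0|rk_gt0] := posnP (r %/ 2 ^ k).
  exists (block k + r %% 2 ^ k), 1, 0, 0; split => //.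
  by rewrite [LHS]n_eq r0 !muln0.
have lt_r : r %/ 2 ^ k < 2 ^ (k + half_log k).
  rewrite ltn_divLR ?expn_gt0 // -expnD.
  have -> : k + half_log k + k = 2 * k + half_log k by lia.
  by apply: leq_ltn_trans lt_k; apply: leq_subr.
have [|a [b [a_in b_in ab_eq]]] := @dilates_cover k (r %/ 2 ^ k); first by rewrite rk_gt0.
exists (block k + r %% 2 ^ k), 1, a, b; split; rewrite -?ab_eq //.
  by rewrite /basis a_in !orbT.
by rewrite /basis b_in !orbT.
Qed.

(** * The counting function of the set *)

Definition pure_count (u : nat) := \sum_(1 <= y < (2 ^ u).+1 | pure y) 1.

Lemma sum_true_le (B w n : nat) : \sum_(1 <= m < n.+1) (B <= m < B + w) <= w.
Proof.
suff : \sum_(1 <= m < n.+1) (B <= m < B + w) <= minn w (n.+1 - B) by lia.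
elim: n => [|n IHn]; first by rewrite big_geq.
by rewrite big_nat_recr //=; case: (boolP (_ <= n.+1 < _)); lia.
Qed.

Lemma sum_pow2 t : \sum_(0 <= k < t) 2 ^ k < 2 ^ t.
Proof.
elim: t => [|t IHt]; first by rewrite big_geq.
by rewrite big_nat_recr //= expnS; lia.
Qed.

(** A union bound whose range J does not depend on N, so that the sum over j can later be exchanged
    with the sum over elements. *)
Lemma existsb_le_sum (N : nat) (P : pred nat) J : (forall j, P j -> j < J) ->
  ([exists j : 'I_N, P j] : bool) <= \sum_(0 <= j < J) P j.
Proof.
move=> ltP; case: existsP => // -[j Pj].
rewrite (big_cat_nat (leq0n j) (ltnW (ltP _ Pj))) /=.
by rewrite (big_ltn (ltP _ Pj)) Pj; lia.
Qed.

(** Only the blocks with k < t can start at or below n, and their lengths 2^k add up to less than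
    2^t. *)
Lemma count_in_block t n : n < block t -> \sum_(1 <= m < n.+1) in_block m <= 2 ^ t.
Proof.
move=> lt_n; apply: leq_trans (ltnW (sum_pow2 t)).
apply: (@leq_trans (\sum_(1 <= m < n.+1) \sum_(0 <= k < t) (block k <= m < block k + 2 ^ k))).
  rewrite big_nat_cond [leqRHS]big_nat_cond; apply: leq_sum => m /andP[/andP[_ lt_m] _].
  apply: (@existsb_le_sum _ (fun k => block k <= m < block k + 2 ^ k)) => k /andP[le_k _].
  by rewrite ltnNge; apply/negP => /block_mono; lia.
rewrite exchange_big /=; apply: leq_sum => k _; exact: sum_true_le.
Qed.

Lemma pure_count_sqr u : pure_count u ^ 2 * u.+1 <= 112 ^ 2 * 4 ^ u.
Proof.
apply: leq_trans (pcount_oddprimes u); rewrite leq_mul2r leq_exp2r //; apply/orP; right.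
rewrite /pure_count /pcount big_mkcond [X in _ <= X + _]big_mkcond.
rewrite [X in _ <= _ + X]big_mkcond -big_split /=.
by apply: leq_sum => y _; rewrite /pure; case: (_.-nat y); case: (_.-nat y).
Qed.

Lemma pure_count_triv u : pure_count u <= 2 ^ u.
Proof.
apply: (@leq_trans (\sum_(1 <= y < (2 ^ u).+1) 1)); first exact: leq_sum_pred.
by rewrite sum_nat_const_nat subn1 muln1.
Qed.

Lemma sqr_pow2 j : (2 ^ j) ^ 2 = 4 ^ j.
Proof. by rewrite -expnM mulnC expnM. Qed.

(** The semigroup bound saves sqrt(u+1) >= sqrt(j+1) >= h(j), which cancels the extra factor h(j) in
    the range of y. *)
Lemma pure_count_low j : pure_count (j + half_log j + 2) <= 112 * (4 * 2 ^ j).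
Proof.
set u := j + half_log j + 2; have H := pure_count_sqr u.
have /andP[le_e _] := half_log_bounds j.
have e_gt0 : 0 < 4 ^ half_log j by rewrite expn_gt0.
rewrite -(@leq_exp2r _ _ 2) // !expnMn sqr_pow2 -(leq_pmul2r e_gt0).
apply: (@leq_trans (pure_count u ^ 2 * u.+1)).
  by rewrite leq_mul2l; apply/orP; right; rewrite /u; lia.
apply: leq_trans H _.
rewrite /u !expnD.
by move: (112 ^ 2) (4 ^ 2) (4 ^ j) (4 ^ half_log j) => *; lia.
Qed.

(** Here the saving is only sqrt(t-s+1); since h(t)^2 <= t+1 <= (s+1)^2 (t-s+1), the factor s+1
    makes up for the rest. *)
Lemma pure_count_high t s : s <= t ->
  pure_count (t - s + half_log t + 3) <= 112 * (8 * (2 ^ (t - s) * s.+1)).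
Proof.
move=> le_st; set u := _ + 3; have H := pure_count_sqr u.
have /andP[le_e _] := half_log_bounds t.
rewrite -(@leq_exp2r _ _ 2) //.
have pos : 0 < (t - s).+1 by [].
rewrite -(leq_pmul2r pos); apply: (@leq_trans (pure_count u ^ 2 * u.+1)).
  by rewrite leq_mul2l; apply/orP; right; rewrite /u; lia.
apply: leq_trans H _.
rewrite /u !expnD !expnMn sqr_pow2.
have le1 : 4 ^ half_log t <= s.+1 ^ 2 * (t - s).+1.
  by apply: leq_trans le_e _; nia.
rewrite (_ : 8 ^ 2 = 4 ^ 3) //; move: le1.
move: (112 ^ 2) (4 ^ (t - s)) (4 ^ 3) (4 ^ half_log t) (s.+1 ^ 2) (t - s).+1.
move=> K a b c d p le1; apply: (@leq_trans (K * a * b * (d * p))); last lia.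
by have := leq_mul (leqnn (K * a * b)) le1; lia.
Qed.

Lemma sum_arith_geom t : \sum_(0 <= s < t.+1) 2 ^ (t - s) * s.+1 <= 4 * 2 ^ t.
Proof.
suff : \sum_(0 <= s < t.+1) 2 ^ (t - s) * s.+1 + t + 3 = 4 * 2 ^ t by lia.
elim: t => [|t IHt]; first by rewrite big_nat1.
rewrite big_nat_recr //= subnn expn0 mul1n.
have -> : \sum_(0 <= s < t.+1) 2 ^ (t.+1 - s) * s.+1 =
          2 * \sum_(0 <= s < t.+1) 2 ^ (t - s) * s.+1.
  rewrite big_distrr; apply: eq_big_nat => s /andP[_ lt_s].
  by rewrite /= subSn // expnS mulnA.
by rewrite expnS; lia.
Qed.

Lemma sum_geom_tail w : \sum_(0 <= j < w) 2 ^ (w - j.+1) < 2 ^ w.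
Proof.
elim: w => [|w IHw]; first by rewrite big_geq.
rewrite big_nat_recl // subSS subn0 expnS; under eq_bigr do rewrite subSS.
lia.
Qed.

(** Count by the exponent j. For j <= t the cap on y gives 896 * 2^t. For j = t+s with 1 <= s <= t
    the bound y <= n / 2^j gives 3584 * 2^t. For j > 2t counting every y gives 8 * 2^t. *)
Lemma count_in_dilates t n : n < 2 ^ (2 * t + half_log t + 3) ->
  \sum_(1 <= m < n.+1) in_dilates m <= 4500 * 2 ^ t.
Proof.
move=> lt_n; set e := half_log t in lt_n.
pose Q j y := (y <= 2 ^ (j + half_log j + 2)) && pure y.
pose D j := \sum_(1 <= y < (n %/ 2 ^ j).+1) Q j y.
have le_D : \sum_(1 <= m < n.+1) in_dilates m <= \sum_(0 <= j < 2 * t + e + 3) D j.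
  apply: (@leq_trans (\sum_(1 <= m < n.+1) \sum_(0 <= j < 2 * t + e + 3)
      ((2 ^ j %| m) && Q j (m %/ 2 ^ j)))).
    rewrite big_nat_cond [leqRHS]big_nat_cond; apply: leq_sum => m /andP[/andP[m_gt0 lt_m] _].
    apply: (@existsb_le_sum _ (fun j => (2 ^ j %| m) && Q j (m %/ 2 ^ j))) => j /andP[dv _].
    rewrite -(ltn_exp2l _ _ (isT : 1 < 2)); apply: leq_ltn_trans lt_n.
    by apply: leq_trans (dvdn_leq m_gt0 dv) _.
  rewrite exchange_big /=; apply: leq_sum => j _.
  have p_gt0 : 0 < 2 ^ j by rewrite expn_gt0.
  have := sum_multiples n xpredT (fun m => Q j (m %/ 2 ^ j) : nat) p_gt0.
  rewrite /= /D => E.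
  apply: (@leq_trans (\sum_(1 <= m < n.+1 | 2 ^ j %| m) Q j (m %/ 2 ^ j))).
    by rewrite [leqRHS]big_mkcond; apply: leq_sum => m _; case: (_ %| _).
  by rewrite E; apply: leq_sum => m _; rewrite mulnK.
have D_le j u : (forall y, y <= n %/ 2 ^ j -> Q j y -> y <= 2 ^ u) -> D j <= pure_count u.
  move=> le_u; apply: (@leq_trans (\sum_(1 <= y < (n %/ 2 ^ j).+1 | Q j y) 1)).
    by rewrite [leqRHS]big_mkcond; apply: leq_sum => y _; case: (Q j y).
  rewrite /pure_count (sum_nat_ltn _ _ (leq_maxl _ (2 ^ u))).
  rewrite [leqRHS](sum_nat_ltn _ _ (leq_maxr (n %/ 2 ^ j) _)).
  apply: leq_sum_pred => y /andP[Qy le_y].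
  by rewrite (le_u y le_y Qy) andbT; case/andP: Qy.
have D_low j : D j <= pure_count (j + half_log j + 2).
  by apply: D_le => y _ /andP[].
have D_high j u : j + u = 2 * t + e + 3 -> D j <= pure_count u.
  move=> eq_ju; apply: D_le => y le_y _; apply: leq_trans le_y _.
  by rewrite -ltnS ltn_divLR ?expn_gt0 // mulSn -expnD [u + j]addnC eq_ju ltn_addl.
apply: leq_trans le_D _.
have r1 : t.+1 <= 2 * t + e + 3 by lia.
have r2 : t.+1 <= 2 * t + 1 by lia.
have r3 : 2 * t + 1 <= 2 * t + e + 3 by lia.
rewrite (big_cat_nat (leq0n _) r1) (big_cat_nat r2 r3) /=.
have low : \sum_(0 <= j < t.+1) D j <= 112 * (4 * 2 ^ t.+1).
  apply: leq_trans (leq_mul (leqnn 112) (leq_mul (leqnn 4) (ltnW (sum_pow2 t.+1)))).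
  rewrite !big_distrr /=; apply: leq_sum => j _.
  exact: leq_trans (D_low j) (pure_count_low j).
have mid : \sum_(t.+1 <= j < 2 * t + 1) D j <= 112 * (8 * (4 * 2 ^ t)).
  apply: leq_trans (leq_mul (leqnn 112) (leq_mul (leqnn 8) (sum_arith_geom t))).
  have -> : \sum_(t.+1 <= j < 2 * t + 1) D j = \sum_(1 <= s < t.+1) D (s + t).
    by rewrite -[t.+1]add1n big_addn (_ : 2 * t + 1 - t = 1 + t) //; lia.
  rewrite !big_distrr /= [leqRHS]big_ltn //; apply: leq_trans (leq_addl _ _).
  rewrite big_nat_cond [leqRHS]big_nat_cond; apply: leq_sum => s /andP[/andP[_ lt_s] _].
  have le_st : s <= t by lia.
  apply: leq_trans (pure_count_high le_st); apply: D_high; lia.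
have high : \sum_(2 * t + 1 <= j < 2 * t + e + 3) D j <= 2 * 2 ^ (e + 2).
  apply: leq_trans (leq_mul (leqnn 2) (ltnW (sum_geom_tail (e + 2)))).
  rewrite -{1}[2 * t + 1]add0n big_addn.
  have -> : 2 * t + e + 3 - (2 * t + 1) = e + 2 by lia.
  rewrite big_distrr /= big_nat_cond [leqRHS]big_nat_cond.
  apply: leq_sum => i /andP[/andP[_ lt_i] _].
  rewrite -expnS; apply: leq_trans (pure_count_triv _); apply: D_high; lia.
have le_e : 2 ^ e <= 2 ^ t by rewrite leq_exp2l //; have := half_log_le t; rewrite /e; lia.
rewrite expnD in high; rewrite expnS in low.
by rewrite (_ : 2 ^ 2 = 4) // in high; lia.
Qed.

(** The constant is 4500 for the dilates, 4 for the blocks below t+2, and 1 for the element 1. *)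
Lemma count_basis t n : n < block t.+2 -> \sum_(1 <= m < n.+1) basis m <= 4505 * 2 ^ t.
Proof.
move=> lt_n.
have lt_n' : n < 2 ^ (2 * t + half_log t + 3).
  apply: leq_trans lt_n _; rewrite leq_exp2l //.
  have : half_log t.+1 <= (half_log t).+1 by apply: leq_half_log; lia.
  lia.
have := count_in_block lt_n; have := count_in_dilates lt_n'.
have := sum_true_le 1 1 n; rewrite !expnS.
have : \sum_(1 <= m < n.+1) basis m <= \sum_(1 <= m < n.+1) (1 <= m < 1 + 1) +
   \sum_(1 <= m < n.+1) in_block m + \sum_(1 <= m < n.+1) in_dilates m.
  rewrite -!big_split /= big_nat_cond [leqRHS]big_nat_cond.
  apply: leq_sum => m /andP[/andP[m_gt0 _] _].
  by rewrite /basis m_gt0; case: (m < 2); case: (in_block m); case: (in_dilates m).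
have := expn_gt0 2 t; rewrite /=; lia.
Qed.

(** * Real estimates *)

Lemma length_filter_le (A B : nat -> bool) u s :
  length (List.filter (fun n => A n && B n) (List.seq s u)) <= \sum_(s <= m < s + u) A m.
Proof.
elim: u s => [|u IHu] s; first by rewrite addn0 big_geq.
rewrite addnS big_ltn ?leq_addr //= -addSn.
by have := IHu s.+1; case: (A s); case: (B s) => /=; lia.
Qed.

Lemma INR_expn2 n : INR (2 ^ n) = pow 2 n.
Proof. by elim: n => [|n IHn] //; rewrite expnS mult_INR IHn. Qed.

Lemma INR_leq m n : m <= n -> Rle (INR m) (INR n).
Proof. by move=> /leP; apply: le_INR. Qed.

Open Scope R_scope.

Lemma pow2_le_exp n : 2 ^ n <= exp (INR n).
Proof.
elim: n => [|n IHn]; first by rewrite /= exp_0; lra.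
rewrite S_INR exp_plus /= Rmult_comm.
apply: Rmult_le_compat => //; [apply: pow_le; lra | lra |].
by have := exp_ineq1_le 1; lra.
Qed.

Lemma Rpower_quarter_pow4 y : 0 < y -> Rpower (y ^ 4) (1 / 4) = y.
Proof.
move=> y_gt0; rewrite -Rpower_pow // Rpower_mult.
have -> : INR 4 * (1 / 4) = 1 by rewrite /=; lra.
exact: Rpower_1.
Qed.

(** As 2 <= exp 1, ln X is at most the exponent of [block t.+2], hence at most 4(t+1) <= 16 * 4^e,
    the fourth power of the right side. *)
Lemma ln_quarter_le t X : 1 < X -> X <= INR (block t.+2) ->
  Rpower (ln X) (1 / 4) <= 2 * sqrt (2 ^ half_log t).
Proof.
move=> X_gt1 le_X; set e := half_log t.
have p_gt0 : 0 < 2 ^ e by apply: pow_lt; lra.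
have s_gt0 := sqrt_lt_R0 _ p_gt0.
have ln_gt0 : 0 < ln X by rewrite -ln_1; apply: ln_increasing; lra.
rewrite -[X in _ <= X]Rpower_quarter_pow4; last lra.
apply: Rle_Rpower_l; first lra.
split=> //.
have -> : (2 * sqrt (2 ^ e)) ^ 4 = INR (16 * 4 ^ e)%N.
  rewrite mult_INR (_ : (4 ^ e = 2 ^ e * 2 ^ e)%N); last by rewrite -expnMn.
  rewrite mult_INR INR_expn2 /=.
  by have := sqrt_sqrt (2 ^ e) (Rlt_le _ _ p_gt0); set q := sqrt _ => <-; lra.
apply: (Rle_trans _ (INR (4 * t.+1)%N)).
  have le_exp : X <= exp (INR (4 * t.+1)%N).
    apply: Rle_trans le_X _; apply: Rle_trans (pow2_le_exp _).
    rewrite -INR_expn2; apply: INR_leq; rewrite leq_exp2l //.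
    by have := half_log_le t.+1; lia.
  rewrite -[X in _ <= X]ln_exp; case: le_exp => [lt_exp|<-]; last exact: Rle_refl.
  by apply/Rlt_le/ln_increasing; lra.
apply: INR_leq; have /andP[_] := half_log_bounds t; rewrite expnS -/e; lia.
Qed.

Theorem theorem1p4 :
  exists A : nat -> bool,
    sumset_prod_covers A /\
    exists C X0 : R, 0 < C /\
      forall X : R, X0 <= X ->
        INR (Acount A X) <= C * (sqrt X / Rpower (ln X) (1/4)).
Proof.
exists basis; split.
  move=> n; have [a [b [c [d [*]]]]] := basis_cover n.
  by exists a, b, c, d.
(* The factor 4 is what the comparison of 2^t with sqrt X costs; X >= 3 keeps ln X positive and
   excludes k = 0. *)
exists (INR 4505 * 4), 3; split.
  by apply: Rmult_lt_0_compat; [apply: lt_0_INR; lia | lra].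
move=> X X_ge3; set U := Z.to_nat (up X).
have [up_gt up_le] := archimed X.
have U_eq : INR U = IZR (up X).
  by rewrite INR_IZR_INZ Z2Nat.id //; apply: le_IZR; lra.
have [k /andP[le_U lt_U]] := block_cover U.
case: k le_U lt_U => [_ lt_U|t le_U lt_U].
  have : INR U < INR 1 by apply: lt_INR; move: lt_U; rewrite /block /=; lia.
  by rewrite /= U_eq; lra.
have count_le : INR (Acount basis X) <= INR 4505 * 2 ^ t.
  rewrite -INR_expn2 -mult_INR; apply: INR_leq.
  apply: leq_trans (count_basis lt_U).
  by apply: leq_trans (length_filter_le _ _ _ _) _; rewrite add1n.
apply: Rle_trans count_le _.
rewrite Rmult_assoc; apply: Rmult_le_compat_l; first exact: pos_INR.
have R_gt0 : 0 < Rpower (ln X) (1 / 4) by apply: exp_pos.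
apply: (Rmult_le_reg_r _ _ _ R_gt0).
have -> : 4 * (sqrt X / Rpower (ln X) (1 / 4)) * Rpower (ln X) (1 / 4) = 4 * sqrt X.
  by field; lra.
have t_gt0 : 0 < 2 ^ t by apply: pow_lt; lra.
have le_R : Rpower (ln X) (1 / 4) <= 2 * sqrt (2 ^ half_log t).
  apply: ln_quarter_le; first lra.
  by apply: Rle_trans (INR_leq (ltnW lt_U)); lra.
apply: (Rle_trans _ (2 ^ t * (2 * sqrt (2 ^ half_log t)))).
  by apply: Rmult_le_compat_l; lra.
have X_ge0 : 0 <= X by lra.
apply: Rsqr_incr_0_var; last by have := sqrt_pos X; lra.
have e_gt0 : 0 <= 2 ^ half_log t by apply: pow_le; lra.
have sq1 := sqrt_sqrt _ e_gt0; have sq2 := sqrt_sqrt _ X_ge0.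
(* This product is [block t.+1] <= U <= X + 1 <= 2X. The square of the left side is 4 times it, at
   most 8X, against 16X on the right. *)
have : 2 ^ t * 2 ^ t * 2 ^ half_log t <= 2 * X.
  have -> : 2 ^ t * 2 ^ t * 2 ^ half_log t = INR (block t.+1).
    by rewrite /block INR_expn2 -!pow_add; congr (2 ^ _); lia.
  by have := INR_leq le_U; lra.
by rewrite /Rsqr; move: sq1 sq2; nra.
Qed.
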